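(* For any quantum protocol (allowing arbitrary entangled operations, auxiliary systems, and fully adaptive strategies), the query complexity for solving the black-box distinguishing task below, when the device provides only classical measurement outcomes (no post-measurement states), with constant success probability is $\Omega(\sqrt{d})$.
   Context: Black-box distinguishing task: given query access to a measurement device on a $d$-dimensional system, distinguish between the following two scenarios, each occurring with equal prior probability: (i) the device outputs $i \in \{0,\dots,d-1\}$ uniformly at random and leaves the input state unchanged (equivalently, it implements the trivial POVM $\{M_i = \mathbb{I}/d\}_i$); (ii) the device performs a projective measurement with operators $\{\Pi_i = U |i\rangle\langle i| U^\dagger\}_{i=0}^{d-1}$ on the input state, where $U$ is an unknown $d$-dimensional Haar random unitary, outputs the measurement result $i$, and collapses the input state to the corresponding post-measurement state. In the setting of this theorem, the tester only has access to the classical outcomes of the device. *)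

(* Defs.v *)
From HB Require Import structures.
From mathcomp Require Import all_boot all_order all_algebra.
From mathcomp Require Import complex.
From mathcomp Require Import all_classical all_reals all_analysis.
Set Implicit Arguments. Unset Strict Implicit. Unset Printing Implicit Defensive.
Import Order.TTheory GRing.Theory Num.Theory.
Import numFieldNormedType.Exports.
Local Open Scope ring_scope.

Definition adjmx (R : realType) (m n : nat) (A : 'M[R[i]]_(m, n)) : 'M[R[i]]_(n, m) :=
  (map_mx Num.conj A)^T.

Definition unitary_mx (R : realType) (d : nat) (A : 'M[R[i]]_d) : Prop :=
  A *m adjmx A = 1%:M.

Definition psd (R : realType) (m : nat) (A : 'M[R[i]]_m) : Prop :=
  forall v : 'cV[R[i]]_m, 0 <= (adjmx v *m A *m v) 0 0.

Definition density (R : realType) (m : nat) (A : 'M[R[i]]_m) : Prop :=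
  psd A /\ \tr A = 1.

Definition kraus_channel (R : realType) (m n : nat) (K : seq 'M[R[i]]_(n, m)) : Prop :=
  \sum_(k <- K) (adjmx k *m k) = 1%:M.

Definition apply_channel (R : realType) (m n : nat) (K : seq 'M[R[i]]_(n, m))
  (X : 'M[R[i]]_m) : 'M[R[i]]_n :=
  \sum_(k <- K) (k *m X *m adjmx k).

(** The system S (dimension d) sent to the device is tensored with the
    tester's memory A (dimension m); the basis vector |s> (x) |a> of S (x) A is
    indexed by [mxvec_index s a : 'I_(d * m)].
    [meas_branch Mi X] = Tr_S[(Mi (x) I_A) X] : the (unnormalised) state left
    on the memory when the device, applied to S, reports outcome i and the
    system S is not returned (classical outcomes only). *)
Definition meas_branch (R : realType) (d m : nat) (Mi : 'M[R[i]]_d)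
  (X : 'M[R[i]]_(d * m)) : 'M[R[i]]_m :=
  \matrix_(a, b) \sum_(s < d) \sum_(s' < d)
     Mi s s' * X (mxvec_index s' a) (mxvec_index s b).

(** A general adaptive protocol with memory of dimension m (arbitrary):
    - initial memory state rho0;
    - before each query, depending on the history h of classical outcomes
      obtained so far, a quantum channel E h : A -> S (x) A preparing the
      (possibly entangled) input of the next query;
    - after the last query, depending on the full history h, a two-outcome
      measurement {F h, I - F h} on the memory; outcome F h = "guess scenario
      (ii)". *)
Record protocol (R : realType) (d m : nat) := Protocol {
  p_rho0 : 'M[R[i]]_m;
  p_E : seq 'I_d -> seq 'M[R[i]]_(d * m, m);
  p_F : seq 'I_d -> 'M[R[i]]_m
}.

Definition valid_protocol (R : realType) (d m : nat) (p : protocol R d m) : Prop :=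
  [/\ density (p_rho0 p),
      (forall h, kraus_channel (p_E p h)),
      (forall h, psd (p_F p h)) &
      (forall h, psd (1%:M - p_F p h))].

(** Unnormalised memory state after the outcome history, given in reverse
    order (most recent outcome first), for a device with POVM M. *)
Fixpoint branch_rev (R : realType) (d m : nat) (p : protocol R d m)
  (M : 'I_d -> 'M[R[i]]_d) (hr : seq 'I_d) : 'M[R[i]]_m :=
  match hr with
  | [::] => p_rho0 p
  | i :: hr' => meas_branch (M i) (apply_channel (p_E p (rev hr')) (branch_rev p M hr'))
  end.

Definition accept_prob (R : realType) (d m : nat) (n : nat) (p : protocol R d m)
  (M : 'I_d -> 'M[R[i]]_d) : R :=
  \sum_(h : n.-tuple 'I_d) complex.Re (\tr (p_F p h *m branch_rev p M (rev h))).

Definition trivial_povm (R : realType) (d : nat) : 'I_d -> 'M[R[i]]_d :=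
  fun _ => (d%:R)^-1%:M.

Definition unitary_povm (R : realType) (d : nat) (U : 'M[R[i]]_d) : 'I_d -> 'M[R[i]]_d :=
  fun i => U *m delta_mx i i *m adjmx U.

Definition reim (R : realType) (d : nat) (A : 'M[R[i]]_d) : 'M[R]_(d, d + d) :=
  row_mx (map_mx (@complex.Re R) A) (map_mx (@complex.Im R) A).

(** U is a Haar-random unitary on the probability space (Omega, P): it is
    unitary, (continuous functions of) it are measurable, and its law is
    invariant under left multiplication by any fixed unitary V (tested
    against all bounded continuous functions).  By uniqueness of Haar
    measure on the compact group U(d) this characterises the Haar law. *)
Definition haar_distributed (R : realType) (d : nat) (d0 : measure_display)
  (Omega : measurableType d0) (P : probability Omega R)
  (U : Omega -> 'M[R[i]]_d) : Prop :=
  [/\ (forall w, unitary_mx (U w)),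
      (forall f : 'M[R]_(d, d + d) -> R, continuous f ->
         measurable_fun setT (fun w => f (reim (U w)))) &
      (forall V : 'M[R[i]]_d, unitary_mx V ->
       forall f : 'M[R]_(d, d + d) -> R, continuous f ->
         (exists M : R, forall x, `|f x| <= M) ->
         (\int[P]_w (f (reim (V *m U w)))%:E =
          \int[P]_w (f (reim (U w)))%:E)%E)].

(** Success probability with equal priors 1/2 on the two scenarios: the
    protocol should output "(i)" (rejection) in scenario (i) and "(ii)"
    (acceptance) in scenario (ii), where U is Haar random. *)
Definition success_prob (R : realType) (d : nat) (d0 : measure_display)
  (Omega : measurableType d0) (P : probability Omega R)
  (U : Omega -> 'M[R[i]]_d) (n m : nat) (p : protocol R d m) : \bar R :=
  (((1 - accept_prob n p (@trivial_povm R d)) / 2)%:E +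
   (2^-1)%:E * \int[P]_w (accept_prob n p (unitary_povm (U w)))%:E)%E.

(* Main.v *)
Require Import Defs.
From HB Require Import structures.
From mathcomp Require Import all_boot all_order all_algebra.
From mathcomp Require Import complex spectral sesquilinear.
From mathcomp Require Import all_classical all_reals all_analysis.
From mathcomp Require Import measurable_realfun ring lra.
Import Order.TTheory GRing.Theory Num.Theory.
Import numFieldNormedType.Exports.
Set Implicit Arguments. Unset Strict Implicit. Unset Printing Implicit Defensive.
Local Open Scope ring_scope.

(** Let [u_j] be the columns of [U].  Along one choice of Kraus operators, the
    weight of the outcomes [j_n, ..., j_1] together with a positive effect [G] is
    a positive quadratic form of an operator that is antilinear in each of
    [u_(j_n), ..., u_(j_1)].  Unitarity of [U] says that summing this weight over
    the last outcome [j] removes the last query and replaces [G] by its pull-back,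
    exactly as one query to the trivial device does up to the factor [1/d].  In
    this sum the outcomes [j] that are new all have the same Haar expectation [f],
    and one that repeats an earlier outcome has expectation at most [2 f]: rotate
    the two columns into each other with a random phase and use right invariance.
    Hence each query with a new outcome costs at most a factor
    [(d + n - 1)/d], and a history of [n] distinct outcomes is rejected with
    probability at least [prod_(k < n) d/(d + k) >= 1 - n^2/d] times its
    probability for the trivial device.  There the history is uniform, so it has
    a repetition with probability at most [n^2/d].  The success probability is
    therefore at most [1/2 + n^2/d]. *)

(** * Adjoints and positive matrices *)

Section Adjoint.
Variable R : realType.
Local Notation C := R[i].

Lemma adjmxE m n (A : 'M[C]_(m, n)) i j : adjmx A i j = (A j i)^*.
Proof. by rewrite !mxE. Qed.

Lemma adjmxK m n (A : 'M[C]_(m, n)) : adjmx (adjmx A) = A.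
Proof. by apply/matrixP => i j; rewrite !adjmxE conjCK. Qed.

Lemma adjmxM m n p (A : 'M[C]_(m, n)) (B : 'M[C]_(n, p)) :
  adjmx (A *m B) = adjmx B *m adjmx A.
Proof. by rewrite /adjmx map_mxM trmx_mul. Qed.

Lemma adjmxD m n (A B : 'M[C]_(m, n)) : adjmx (A + B) = adjmx A + adjmx B.
Proof. by rewrite /adjmx map_mxD linearD. Qed.

Lemma adjmxN m n (A : 'M[C]_(m, n)) : adjmx (- A) = - adjmx A.
Proof. by rewrite /adjmx map_mxN linearN. Qed.

Lemma adjmxZ m n (a : C) (A : 'M[C]_(m, n)) : adjmx (a *: A) = a^* *: adjmx A.
Proof. by rewrite /adjmx map_mxZ linearZ. Qed.

Lemma adjmx1 n : adjmx (1%:M : 'M[C]_n) = 1%:M.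
Proof. by rewrite /adjmx map_mx1 trmx1. Qed.

Lemma adjmx0 m n : adjmx (0 : 'M[C]_(m, n)) = 0.
Proof. by rewrite /adjmx map_mx0 trmx0. Qed.

Lemma adjmx_sum m n (I : Type) (r : seq I) (F : I -> 'M[C]_(m, n)) :
  adjmx (\sum_(i <- r) F i) = \sum_(i <- r) adjmx (F i).
Proof. by elim/big_rec2: _ => [|i x y _ <-]; rewrite ?adjmx0 // adjmxD. Qed.

Lemma mxtrace_sum n (I : Type) (r : seq I) (F : I -> 'M[C]_n) :
  \tr (\sum_(i <- r) F i) = \sum_(i <- r) \tr (F i).
Proof. exact: (raddf_sum (@mxtrace C n)). Qed.

Lemma ReD (x y : C) : complex.Re (x + y) = complex.Re x + complex.Re y.
Proof. by case: x; case: y. Qed.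

Lemma ImD (x y : C) : complex.Im (x + y) = complex.Im x + complex.Im y.
Proof. by case: x; case: y. Qed.

Lemma ReB (x y : C) : complex.Re (x - y) = complex.Re x - complex.Re y.
Proof. by case: x; case: y. Qed.

Lemma Re_sum (I : Type) (r : seq I) (P : pred I) (F : I -> C) :
  complex.Re (\sum_(i <- r | P i) F i) = \sum_(i <- r | P i) complex.Re (F i).
Proof. by elim/big_rec2: _ => [|i x y _ <-] //; rewrite ReD. Qed.

Lemma Re_ge0 (x : C) : 0 <= x -> 0 <= complex.Re x.
Proof. by rewrite lecE => /andP[]. Qed.

Lemma ReMl (a : R) (x : C) : complex.Re (a%:C%C * x) = a * complex.Re x.
Proof. by case: x => x y /=; rewrite mul0r subr0. Qed.

Lemma ReM (x y : C) :
  complex.Re (x * y) =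
  complex.Re x * complex.Re y - complex.Im x * complex.Im y.
Proof. by case: x; case: y. Qed.

Lemma ImM (x y : C) :
  complex.Im (x * y) =
  complex.Re x * complex.Im y + complex.Im x * complex.Re y.
Proof. by case: x; case: y. Qed.

Lemma Re_conj (x : C) : complex.Re x^* = complex.Re x.
Proof. by case: x. Qed.

Lemma Im_conj (x : C) : complex.Im x^* = - complex.Im x.
Proof. by case: x. Qed.

(* A positive form is real-valued, and polarization with the vectors
   [e_i + e_j] and [e_i + 'i e_j] recovers the off-diagonal entries. *)
Lemma psd_hermitian m (A : 'M[C]_m) : psd A -> adjmx A = A.
Proof.
move=> pA.
have formE (u v : 'cV[C]_m) (a b : C) :
    (adjmx (a *: u + b *: v) *m A *m (a *: u + b *: v)) 0 0 =
    a^* * a * (adjmx u *m A *m u) 0 0 + b^* * b * (adjmx v *m A *m v) 0 0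
    + a^* * b * (adjmx u *m A *m v) 0 0 + b^* * a * (adjmx v *m A *m u) 0 0.
  rewrite adjmxD !adjmxZ !mulmxDl !mulmxDr -!scalemxAl -!scalemxAr.
  by rewrite !scalerA !mxE; ring.
have entry i j : (adjmx (delta_mx i 0 : 'cV[C]_m) *m A
    *m (delta_mx j 0 : 'cV[C]_m)) 0 0 = A i j.
  have -> : adjmx (delta_mx i 0 : 'cV[C]_m) = delta_mx 0 i.
    by apply/matrixP => k l; rewrite !mxE rmorph_nat andbC.
  by rewrite -rowE -colE !mxE.
have im0 (v : 'cV[C]_m) : complex.Im ((adjmx v *m A *m v) 0 0) = 0.
  by have := pA v; rewrite lecE => /andP[/eqP].
apply/matrixP => i j; rewrite adjmxE.
have := im0 (1 *: delta_mx i 0 + 1 *: delta_mx j 0).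
have := im0 (1 *: delta_mx i 0 + 'i%C *: delta_mx j 0).
have := im0 (delta_mx i 0); have := im0 (delta_mx j 0).
rewrite !formE !entry !ImD !ImM !ReM !Re_conj !Im_conj /= => -> -> h1 h2.
apply/eqP; rewrite eq_complex Re_conj Im_conj; apply/andP; split; apply/eqP.
  by move: h1; lra.
by move: h2; lra.
Qed.

(** A positive matrix is Hermitian, hence normal, so the spectral theorem applies. The rank-one form
    lets [qform_ge0] treat a state one vector at a time. *)
Lemma psd_diag m (A : 'M[C]_m) : psd A ->
  exists (P : 'M[C]_m) (D : 'I_m -> C),
    (forall i, 0 <= D i) /\ A = \sum_i D i *: (col i P *m adjmx (col i P)).
Proof.
move=> pA; have hA := psd_hermitian pA.
have nA : A \is normalmx.
  apply/normalmxP; rewrite (_ : map_mx _ _ = adjmx A) ?hA //.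
  by rewrite -[RHS]hA /adjmx map_trmx.
have /orthomx_spectralP := nA; set P := spectralmx A => eA.
have uP : P \is unitarymx by exact: spectral_unitarymx.
have aP : map_mx Num.conj P^T = adjmx P by rewrite /adjmx map_trmx.
have eA2 : A = adjmx P *m diag_mx (spectral_diag A) *m P.
  by rewrite {1}eA (invmx_unitary uP) aP.
have PP : P *m adjmx P = 1%:M by move/unitarymxP: uP; rewrite aP.
exists (adjmx P), (fun i => spectral_diag A 0 i); split=> [i|].
  have := pA (col i (adjmx P)).
  suff -> : (adjmx (col i (adjmx P)) *m A *m col i (adjmx P)) 0 0 =
     spectral_diag A 0 i by [].
  rewrite [in LHS]eA2 (_ : adjmx (col i (adjmx P)) = row i P); last first.
    by apply/matrixP => a b; rewrite !mxE conjCK.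
  rewrite rowE colE !mulmxA -(mulmxA _ P (adjmx P)) PP mulmx1.
  rewrite -(mulmxA _ P (adjmx P)) PP mulmx1.
  by rewrite -colE -rowE !mxE eqxx mulr1n.
rewrite [LHS]eA2.
apply/matrixP => a b; rewrite !mxE summxE; apply: eq_bigr => i _.
rewrite !mxE big_ord1 !mxE conjCK (bigD1 i) //= big1 ?addr0.
  by rewrite !mxE eqxx mulr1n mulrAC mulrC.
by move=> j ji; rewrite !mxE (negPf ji) mulr0n mulr0.
Qed.

End Adjoint.

(** * Quadratic forms and reflections *)

Section QuadraticForm.
Variables (R : realType) (m : nat).
Local Notation C := R[i].
Implicit Types G rho X Y Z : 'M[C]_m.

(** For positive [G] and [rho] this is a semi-inner product on operators; on the diagonal it is the
    unnormalised probability of the effect [G] after the Kraus operator [X] has acted on the state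
    [rho]. *)
Definition sform G rho X Y : C := \tr (G *m X *m rho *m adjmx Y).

Definition qform G rho X : R := complex.Re (sform G rho X X).

Lemma sformDl G rho X X' Y :
  sform G rho (X + X') Y = sform G rho X Y + sform G rho X' Y.
Proof. by rewrite /sform mulmxDr !mulmxDl linearD. Qed.

Lemma sformDr G rho X Y Y' :
  sform G rho X (Y + Y') = sform G rho X Y + sform G rho X Y'.
Proof. by rewrite /sform adjmxD mulmxDr linearD. Qed.

Lemma sformZl G rho a X Y : sform G rho (a *: X) Y = a * sform G rho X Y.
Proof. by rewrite /sform -scalemxAr -!scalemxAl linearZ. Qed.

Lemma sformZr G rho a X Y : sform G rho X (a *: Y) = a^* * sform G rho X Y.
Proof. by rewrite /sform adjmxZ -scalemxAr linearZ. Qed.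

(** Splitting [rho] into eigenvectors [v] leaves a nonnegative combination of the values of [G] at
    the vectors [X *m v]. *)
Lemma qform_ge0 G rho X : psd G -> psd rho -> 0 <= qform G rho X.
Proof.
move=> pG /psd_diag[P [D [D_ge0 ->]]]; rewrite /qform /sform.
rewrite mulmx_sumr mulmx_suml mxtrace_sum Re_sum sumr_ge0 // => i _.
apply: Re_ge0; rewrite -scalemxAr -scalemxAl linearZ /= mulr_ge0 //.
set v := col i P.
have -> : G *m X *m (v *m adjmx v) *m adjmx X = (G *m X *m v) *m adjmx (X *m v).
  by rewrite adjmxM !mulmxA.
rewrite mxtrace_mulC !mulmxA -mulmxA -mulmxA.
have := pG (X *m v); rewrite -!mulmxA.
by rewrite /mxtrace big_ord1.
Qed.

Lemma qformZ G rho (a : R) X : qform G rho (a%:C%C *: X) = a ^+ 2 * qform G rho X.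
Proof.
have e : (a%:C%C)^* = a%:C%C :> C by exact: conjc_real.
by rewrite /qform sformZl sformZr e !ReMl mulrA expr2.
Qed.

Lemma qform_parallelogram G rho X Y :
  qform G rho (X + Y) + qform G rho (X + (-1) *: Y)
  = 2 * (qform G rho X + qform G rho Y).
Proof.
rewrite /qform !(sformDl, sformDr, sformZl, sformZr) rmorphN rmorph1.
move: (sform G rho X X) (sform G rho X Y) (sform G rho Y X) (sform G rho Y Y).
move=> a b c e; rewrite !mulN1r opprK -!addrA -ReD.
have -> : a + (b + (c + e)) + (a + (- b + (- c + e))) = 2 * (a + e) by ring.
by rewrite -[2]/(2%:R) mulr_natl mulr2n ReD ReD -mulr2n mulr_natl.
Qed.

(** The parallelogram identity with the nonnegative form of the difference dropped. *)
Lemma qformD_le G rho X Y : psd G -> psd rho ->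
  qform G rho (X + Y) <= 2 * qform G rho X + 2 * qform G rho Y.
Proof.
move=> pG prho; rewrite -mulrDr -qform_parallelogram lerDl.
exact: qform_ge0.
Qed.

(* Averaging over the phases [1, 'i, -1, -'i] kills all the cross terms. *)
Lemma qform_phase_sum G rho X Y Z :
  qform G rho (X + Y + Z) + qform G rho (X + 'i%C *: Y + (-1) *: Z)
  + qform G rho (X + (-1) *: Y + Z) + qform G rho (X + (- 'i%C) *: Y + (-1) *: Z)
  = 4 * (qform G rho X + qform G rho Y + qform G rho Z).
Proof.
have iY : qform G rho ('i%C *: Y) = qform G rho Y.
  rewrite /qform sformZl sformZr mulrA.
  suff -> : 'i%C * ('i%C)^* = 1 :> C by rewrite mul1r.
  by apply/eqP; rewrite eq_complex /=; apply/andP; split; apply/eqP; ring.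
rewrite -[- 'i%C]mulN1r -scalerA [X + Y + Z]addrAC
  [X + 'i%C *: Y + _]addrAC [X + (-1) *: Y + Z]addrAC
  [X + (-1) *: ('i%C *: Y) + _]addrAC -[LHS]addrA [LHS]addrACA.
rewrite !qform_parallelogram iY -mulrDr addrACA qform_parallelogram.
by move: (qform G rho X) (qform G rho Y) (qform G rho Z) => x y z; ring.
Qed.

End QuadraticForm.

(** * Householder reflections acting on two columns *)

Section Householder.
Variables (R : realType) (d : nat).
Local Notation C := R[i].
Implicit Types (U : 'M[C]_d) (a b : 'I_d) (z w : C).

Definition mixvec a b z : 'cV[C]_d := delta_mx a 0 + z *: delta_mx b 0.

(** For [a != b], the reflection in the hyperplane orthogonal to [mixvec a b z], a vector of squared
    norm [1 + z * z^*]. Multiplying by it on the right mixes the columns [a] and [b] and fixes the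
    others. *)
Definition mixmx a b z : 'M[C]_d :=
  1%:M - (2 / (1 + z * z^*)) *: (mixvec a b z *m adjmx (mixvec a b z)).

Lemma mixvec_norm a b z : a != b ->
  adjmx (mixvec a b z) *m mixvec a b z = (1 + z * z^*)%:M.
Proof.
move=> ab; apply/matrixP => i j; rewrite !ord1 mxE (bigD1 a) //= (bigD1 b) 1?eq_sym //=.
rewrite big1 ?addr0.
  rewrite !mxE !eqxx [b == a]eq_sym (negPf ab) /= mulr1n mulr0 mulr1 !addr0 add0r.
  by rewrite rmorph1 mulr1 mulrC.
by move=> k /andP[ka kb]; rewrite !mxE (negPf ka) (negPf kb) /= mulr0 addr0 mulr0.
Qed.

Lemma normsq_ge0 z : 0 <= z * z^*.
Proof. exact: mul_conjC_ge0. Qed.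

Lemma mixmx_unitary a b z : a != b -> unitary_mx (mixmx a b z).
Proof.
move=> ab; rewrite /unitary_mx /mixmx.
set c : C := 1 + z * z^*; set k : C := 2 / c.
have c_neq0 : c != 0 by rewrite gt_eqF // ltr_wpDr ?normsq_ge0.
have kJ : k^* = k.
  by apply/CrealP/ger0_real; rewrite divr_ge0 // addr_ge0 // normsq_ge0.
have := mixvec_norm z ab; rewrite -/c; move: (mixvec a b z) => y yy.
rewrite adjmxD adjmxN adjmxZ adjmxM adjmxK adjmx1 kJ.
rewrite mulmxDl mulmxDr mulmxDr !mul1mx !mulmx1 mulNmx mulmxN opprK.
rewrite -scalemxAl -scalemxAr mulmxA -(mulmxA y) yy mul_mx_scalar -scalemxAl.
rewrite !scalerA -addrA -scaleNr -!scalerDl.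
rewrite [X in X *: _](_ : _ = 0) ?scale0r ?addr0 //.
by rewrite /k; field.
Qed.

Lemma col_mixmx U a b z i : col i (U *m mixmx a b z) =
  col i U - (2 / (1 + z * z^*) * (mixvec a b z i 0)^*) *: (col a U + z *: col b U).
Proof.
have -> : col a U + z *: col b U = U *m mixvec a b z.
  by rewrite mulmxDr -scalemxAr -!colE.
rewrite /mixmx mulmxDr mulmx1 mulmxN -scalemxAr mulmxA.
apply/matrixP => j k; rewrite !mxE big_ord1 !mxE !ord1; ring.
Qed.

Lemma col_mixmx_id U a b z i : i != a -> i != b ->
  col i (U *m mixmx a b z) = col i U.
Proof.
move=> ia ib; rewrite col_mixmx !mxE (negPf ia) (negPf ib) /= mulr0 addr0.
by rewrite rmorph0 mulr0 scale0r subr0.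
Qed.

(** Reflecting along the difference of two basis vectors exchanges them. *)
Definition swapmx a b := mixmx a b (-1).

Lemma swapmx_unitary a b : a != b -> unitary_mx (swapmx a b).
Proof. exact: mixmx_unitary. Qed.

Lemma swapmx_coef : 2 / (1 + (-1) * (-1)^*) = 1 :> C.
Proof. by rewrite rmorphN rmorph1 mulrNN mulr1 -mulr2n divff ?pnatr_eq0. Qed.

Lemma col_swapmxl U a b : a != b -> col a (U *m swapmx a b) = col b U.
Proof.
move=> ab; rewrite col_mixmx swapmx_coef !mxE !eqxx (negPf ab) /= mulr0 addr0.
by rewrite rmorph1 mulr1 scale1r scaleN1r opprB addrC subrK.
Qed.

Lemma col_swapmxr U a b : a != b -> col b (U *m swapmx a b) = col a U.
Proof.
move=> ab; rewrite col_mixmx swapmx_coef !mxE !eqxx eq_sym (negPf ab) /= mulr1 add0r.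
by rewrite rmorphN rmorph1 mulrN1 !scaleN1r opprK addrCA subrr addr0.
Qed.

(* The coefficients are rational because [3^2 + 4^2 = 5^2]. *)
Lemma col_mixmx_phase U a b w : a != b -> w * w^* = 1 ->
  col a (U *m mixmx a b (2 * w)) =
  (3 / 5)%:C%C *: col a U + (- (4 / 5)%:C%C * w) *: col b U.
Proof.
move=> ab ww; rewrite col_mixmx !mxE !eqxx (negPf ab) /= mulr0 addr0 rmorph1 mulr1.
have -> : 1 + 2 * w * (2 * w)^* = 5 :> C.
  by rewrite rmorphM rmorph_nat mulrACA ww; ring.
rewrite !(rmorphM, fmorphV) /= !(rmorph_nat (real_complex R)).
by apply/matrixP => i j; rewrite !mxE; field.
Qed.

End Householder.

(** * Amplitudes along a choice of Kraus operators *)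

Section Amplitude.
Variables (R : realType) (d m : nat).
Local Notation C := R[i].
Implicit Types (U V : 'M[C]_d) (A : 'I_d -> 'M[C]_m) (G rho : 'M[C]_m).
Implicit Types (As : seq ('I_d -> 'M[C]_m)) (js : seq 'I_d).

(** With [A s] the block of a Kraus operator at the basis vector [s] of the system, this contracts
    the system with the adjoint of [x]; hence the conjugate. *)
Definition step A (x : 'cV[C]_d) : 'M[C]_m := \sum_s (x s 0)^* *: A s.

Lemma stepD A x y : step A (x + y) = step A x + step A y.
Proof.
by rewrite /step -big_split; apply: eq_bigr => s _; rewrite mxE rmorphD scalerDl.
Qed.

Lemma stepZ A a x : step A (a *: x) = a^* *: step A x.
Proof.
by rewrite /step scaler_sumr; apply: eq_bigr => s _; rewrite mxE rmorphM scalerA.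
Qed.

(* The amplitude of the outcomes [js] (latest first) along one choice of Kraus
   operators, when outcome [j] has the effect [u_j u_j^*] with [u_j] the [j]-th
   column of [U]. *)
Fixpoint amp As js U : 'M[C]_m :=
  match As, js with
  | A :: As', j :: js' => step A (col j U) *m amp As' js' U
  | _, _ => 1%:M
  end.

Lemma amp_cat As1 As2 js1 js2 U : size As1 = size js1 ->
  amp (As1 ++ As2) (js1 ++ js2) U = amp As1 js1 U *m amp As2 js2 U.
Proof.
elim: As1 js1 => [|A As1 IH] [|j js1] //=; first by rewrite mul1mx.
by case=> e; rewrite IH // mulmxA.
Qed.

Lemma eq_amp As js U V : (forall j, j \in js -> col j U = col j V) ->
  amp As js U = amp As js V.
Proof.
elim: As js => [|A As IH] [|j js] //= h; rewrite h ?mem_head // IH // => k kjs.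
by rewrite h // in_cons kjs orbT.
Qed.

Definition weight G rho As js U : R := qform G rho (amp As js U).

Lemma weight_ge0 G rho As js U : psd G -> psd rho -> 0 <= weight G rho As js U.
Proof. exact: qform_ge0. Qed.

(** The Heisenberg picture of one query whose system is traced out: up to the factor [1/d], the
    effect of a query to the trivial device. *)
Definition pull A G : 'M[C]_m := \sum_s adjmx (A s) *m G *m A s.

Lemma pull_psd A G : psd G -> psd (pull A G).
Proof.
move=> pG v; rewrite /pull mulmx_sumr mulmx_suml summxE sumr_ge0 // => s _.
by have := pG (A s *m v); rewrite adjmxM !mulmxA.
Qed.

(** The blocks [s] and [t] meet with the coefficient [(U *m adjmx U) s t], so unitarity keeps only
    the diagonal terms. *)
Lemma sum_step_pull A G U : unitary_mx U ->
  \sum_j adjmx (step A (col j U)) *m G *m step A (col j U) = pull A G.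
Proof.
move=> UU; rewrite /pull.
transitivity (\sum_s \sum_t (U *m adjmx U) s t *: (adjmx (A s) *m G *m A t)).
  under eq_bigr => j _.
    rewrite /step adjmx_sum !mulmx_suml.
    under eq_bigr => s _.
      rewrite mulmx_sumr.
      under eq_bigr => t _.
        rewrite adjmxZ conjCK -!scalemxAl -scalemxAr scalerA !mxE.
      over.
    over.
  over.
  rewrite exchange_big; apply: eq_bigr => s _; rewrite exchange_big.
  by apply: eq_bigr => t _; rewrite mxE scaler_suml; apply: eq_bigr => j _; rewrite !mxE.
apply: eq_bigr => s _; rewrite UU (bigD1 s) //= mxE eqxx scale1r.
by rewrite big1 ?addr0 // => t ts; rewrite mxE eq_sym (negPf ts) scale0r.
Qed.

(** Cyclicity of the trace moves the latest step onto [G], where [sum_step_pull] removes it. *)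
Lemma sum_weight G rho A As js U : unitary_mx U ->
  \sum_j weight G rho (A :: As) (j :: js) U = weight (pull A G) rho As js U.
Proof.
move=> UU; rewrite /weight /qform /sform -(sum_step_pull A G UU) -Re_sum -mxtrace_sum.
congr (complex.Re _); set X := amp As js U.
rewrite !mulmx_suml !mxtrace_sum; apply: eq_bigr => j _ /=; rewrite -/X adjmxM.
by rewrite !mulmxA mxtrace_mulC !mulmxA.
Qed.

(** The earlier part of the amplitude reads neither of the two exchanged columns. *)
Lemma weight_swap G rho A As js i j U : i \notin js -> j \notin js -> i != j ->
  weight G rho (A :: As) (i :: js) (U *m swapmx R i j) =
  weight G rho (A :: As) (j :: js) U.
Proof.
move=> ijs jjs ij; rewrite /weight /= (col_swapmxl _ ij).
rewrite (@eq_amp As js _ U) // => k kjs; apply: col_mixmx_id.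
  by apply: contraNneq ijs => <-.
by apply: contraNneq jjs => <-.
Qed.

(** The amplitude of [a :: js] has degree two in column [a]. After the rotation it splits into three
    terms carrying different powers of the phase; summing over four phases removes their cross
    terms, and [qformD_le] separates the two halves of the middle term, which are the amplitudes for
    [b] before and after the swap. *)
Lemma weight_mix G rho A As js a b U
    (W := fun i V => weight G rho (A :: As) (i :: js) V)
    (H := fun w : C => mixmx a b (2 * w)) : psd G -> psd rho ->
  uniq js -> size As = size js -> a \in js -> b \notin js ->
  W a (U *m H 1) + W a (U *m H 'i%C) + W a (U *m H (-1)) + W a (U *m H (- 'i%C))
  <= 4 * (81 / 625 * W a U + 256 / 625 * W a (U *m swapmx R a b)
          + 144 / 625 * (2 * W b U + 2 * W b (U *m swapmx R a b))).
Proof.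
move=> pG prho ujs sAs ajs bjs.
have ab : a != b by apply: contraNneq bjs => <-.
(* Cut the history at the earlier [a]; by [uniq] it is the only one there. *)
case/splitPr: ajs @W sAs ujs bjs => js1 js2 W sAs ujs bjs.
move: ujs; rewrite cat_uniq /= => /and3P[_ /norP[a1 _] /andP[a2 _]].
move: bjs; rewrite mem_cat in_cons !negb_or => /and3P[b1 _ b2].
have [As1 [B [As2 [eAs sAs1]]]] : exists As1 B As2,
    As = As1 ++ B :: As2 /\ size As1 = size js1.
  have lt1 : (size js1 < size As)%N by rewrite sAs size_cat /= addnS ltnS leq_addr.
  exists (take (size js1) As), (nth (fun=> 0) As (size js1)), (drop (size js1).+1 As).
  by rewrite -drop_nth // cat_take_drop size_takel // ltnW.
set u := col a U; set v := col b U.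
set X1 := amp As1 js1 U; set X2 := amp As2 js2 U.
(* The amplitude with the latest column and the column of the earlier [a] left free; it is
   antilinear in each. *)
pose L x y := step A x *m (X1 *m (step B y *m X2)).
have WE i V : (forall j, j != a -> j != b -> col j V = col j U) ->
    W i V = qform G rho (L (col i V) (col a V)).
  move=> hV.
  have e1 : amp As1 js1 V = X1.
    apply: eq_amp => j jj; apply: hV; first by apply: contraNneq a1 => <-.
    by apply: contraNneq b1 => <-.
  have e2 : amp As2 js2 V = X2.
    apply: eq_amp => j jj; apply: hV; first by apply: contraNneq a2 => <-.
    by apply: contraNneq b2 => <-.
  rewrite /W /weight eAs; congr (qform _ _ _).
  by rewrite [LHS]/(step A (col i V) *m amp (As1 ++ B :: As2) (js1 ++ a :: js2) V)
    (amp_cat _ _ _ sAs1) e1 [amp (B :: _) _ _]/= e2.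
have LDl x x' y : L (x + x') y = L x y + L x' y by rewrite /L stepD mulmxDl.
have LZl c x y : L (c *: x) y = c^* *: L x y by rewrite /L stepZ -scalemxAl.
have LDr x y y' : L x (y + y') = L x y + L x y'.
  by rewrite /L stepD mulmxDl !mulmxDr.
have LZr c x y : L x (c *: y) = c^* *: L x y.
  by rewrite /L stepZ -scalemxAl -!scalemxAr.
(* Both arguments become 3/5 of [u] minus 4/5 of [w *: v]; the products of these coefficients are
   9/25, -12/25 and 16/25, and antilinearity conjugates [w]. *)
have WaH w : w * w^* = 1 -> W a (U *m H w) =
    qform G rho ((9 / 25)%:C%C *: L u u + w^* *: ((- (12 / 25))%:C%C *: (L u v + L v u))
                 + (w^* ^+ 2) *: ((16 / 25)%:C%C *: L v v)).
  move=> ww; rewrite WE => [|j ja jb]; last exact: col_mixmx_id.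
  rewrite /H col_mixmx_phase // -/u -/v; congr (qform _ _ _).
  rewrite LDl !LDr !LZl !LZr.
  move: (L u u) (L u v) (L v u) (L v v) => Luu Luv Lvu Lvv.
  have cR (x : R) : (x%:C%C)^* = x%:C%C :> C by exact: conjc_real.
  rewrite !(rmorphM (@Num.conj C)) !(rmorphN (@Num.conj C)) /= !cR.
  rewrite !(rmorphN, rmorphM, fmorphV) /= !(rmorph_nat (real_complex R)).
  rewrite !scalerDr !scalerA !addrA.
  move: (w^*) => w'.
  have -> : 3 / 5 * (3 / 5) = 9 / 25 :> C by field.
  have -> : 3 / 5 * (- (4 / 5) * w') = w' * - (12 / 25) :> C by field.
  have -> : - (4 / 5) * w' * (3 / 5) = w' * - (12 / 25) :> C by field.
  have -> : - (4 / 5) * w' * (- (4 / 5) * w') = w' ^+ 2 * (16 / 25) :> C by field.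
  by [].
clearbody W L H.
have iJ : ('i%C : C)^* = - 'i%C by apply/eqP; rewrite eq_complex /= oppr0 !eqxx.
have i2 : ('i%C : C) ^+ 2 = - 1 by exact: sqr_i.
have i1 : 'i%C * ('i%C)^* = 1 :> C by rewrite iJ mulrN -expr2 i2 opprK.
have := WE a U (fun _ _ _ => erefl); have := WE b U (fun _ _ _ => erefl).
have sE i := WE i (U *m swapmx R a b) (fun j ja jb => col_mixmx_id U (-1) ja jb).
have := sE a; have := sE b; rewrite (col_swapmxl U ab) (col_swapmxr U ab) -/u -/v {sE WE}.
move=> -> -> -> ->.
have mi1 : (- 'i%C) * (- 'i%C)^* = 1 :> C by rewrite rmorphN mulrNN.
have p1 : 1 * 1^* = 1 :> C by rewrite rmorph1 mulr1.
have m1 : (-1) * (-1)^* = 1 :> C by rewrite rmorphN mulrNN.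
rewrite (WaH _ p1) (WaH _ i1) (WaH _ m1) (WaH _ mi1) {WaH LDl LZl LDr LZr}.
have miJ : (- 'i%C)^* = 'i%C :> C by rewrite -iJ conjCK.
have m1J : (-1)^* = -1 :> C by rewrite rmorphN rmorph1.
have p1J : 1^* = 1 :> C by rewrite rmorph1.
rewrite iJ miJ m1J p1J !sqrrN i2 expr1n !scale1r.
have := @qformD_le _ _ G rho (L u v) (L v u) pG prho.
move: (L u u) (L u v) (L v u) (L v v) => Luu Luv Lvu Lvv.
(* Conjugation exchanges the phases ['i] and [-'i], so the four summands match up to their order. *)
have := qform_phase_sum G rho ((9 / 25)%:C%C *: Luu)
  ((- (12 / 25))%:C%C *: (Luv + Lvu)) ((16 / 25)%:C%C *: Lvv).
rewrite !qformZ [X in X = _]addrAC -![X in X = _]addrA [X in _ + X]addrC !addrA.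
move=> ->; move: (qform G rho (Luv + Lvu)) (qform G rho Luu) (qform G rho Luv).
by move: (qform G rho Lvu) (qform G rho Lvv) => x1 x2 x3 x4 x5; lra.
Qed.

End Amplitude.

(** * Expanding a protocol *)

Local Arguments trivial_povm : simpl never.

Section Protocol.
Variables (R : realType) (d m : nat).
Local Notation C := R[i].
Implicit Types (U : 'M[C]_d) (p : protocol R d m) (G rho : 'M[C]_m).
Implicit Types (M : 'I_d -> 'M[C]_d) (h : seq 'I_d).

(** The basis bra [s] on the system tensored with the identity on the memory. *)
Definition slice (s : 'I_d) : 'M[C]_(m, d * m) :=
  \matrix_(a, c) (c == mxvec_index s a)%:R.

Lemma slice_sandwich (X : 'M[C]_(d * m)) s t a b :
  (slice t *m X *m adjmx (slice s)) a b = X (mxvec_index t a) (mxvec_index s b).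
Proof.
rewrite mxE (bigD1 (mxvec_index s b)) //= big1 ?addr0.
  rewrite !mxE eqxx rmorph1 mulr1 (bigD1 (mxvec_index t a)) //= big1 ?addr0.
    by rewrite !mxE eqxx mul1r.
  by move=> c ct; rewrite !mxE (negPf ct) mul0r.
by move=> c cs; rewrite !mxE (negPf cs) rmorph0 mulr0.
Qed.

Lemma meas_branchE (Mi : 'M[C]_d) (X : 'M[C]_(d * m)) : meas_branch Mi X =
  \sum_s \sum_t Mi s t *: (slice t *m X *m adjmx (slice s)).
Proof.
apply/matrixP => a b; rewrite mxE summxE; apply: eq_bigr => s _.
by rewrite summxE; apply: eq_bigr => t _; rewrite mxE slice_sandwich.
Qed.

Lemma unitary_povmE U i s t : unitary_povm U i s t = U s i * (U t i)^*.
Proof.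
rewrite /unitary_povm -(mul_delta_mx (0 : 'I_1)) mulmxA -mulmxA -colE -rowE.
by rewrite mxE big_ord1 !mxE.
Qed.

Definition kstep (k : 'M[C]_(d * m, m)) (s : 'I_d) : 'M[C]_m := slice s *m k.

Lemma step_kstep k x : step (kstep k) x = (\sum_s (x s 0)^* *: slice s) *m k.
Proof.
by rewrite /step mulmx_suml; apply: eq_bigr => s _; rewrite scalemxAl.
Qed.

(** The effect has rank one, so measuring sandwiches the state between one operator and its adjoint,
    and each Kraus operator of the channel yields a single Kraus operator of the query. *)
Lemma meas_branch_unitary U i (K : seq 'M[C]_(d * m, m)) X :
  meas_branch (unitary_povm U i) (apply_channel K X) =
  \sum_(k <- K) step (kstep k) (col i U) *m X *m adjmx (step (kstep k) (col i U)).
Proof.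
rewrite meas_branchE; under [RHS]eq_bigr do rewrite step_kstep.
pose V := \sum_s (col i U s 0)^* *: slice s.
transitivity (V *m apply_channel K X *m adjmx V); last first.
  rewrite /apply_channel mulmx_sumr mulmx_suml; apply: eq_bigr => k _.
  by rewrite adjmxM !mulmxA.
rewrite /V adjmx_sum mulmx_sumr; apply: eq_bigr => s _.
rewrite !mulmx_suml; apply: eq_bigr => t _.
by rewrite adjmxZ conjCK -scalemxAr -!scalemxAl scalerA unitary_povmE !mxE.
Qed.

(** All choices of one Kraus operator per query along the history [h], latest first. Adaptivity
    enters only here: the available operators depend on the earlier outcomes. *)
Fixpoint chains p h : seq (seq ('I_d -> 'M[C]_m)) :=
  match h with
  | [::] => [:: [::]]
  | _ :: h' => [seq kstep k :: c | k <- p_E p (rev h'), c <- chains p h']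
  end.

Lemma size_chains p h : all (fun c => size c == size h) (chains p h).
Proof.
elim: h => [|i h IH] //=; elim: (p_E p (rev h)) => [|k K IHK] //=.
by rewrite all_cat IHK andbT all_map; apply: sub_all IH.
Qed.

Lemma branch_unitary p U h : branch_rev p (unitary_povm U) h =
  \sum_(c <- chains p h) amp c h U *m p_rho0 p *m adjmx (amp c h U).
Proof.
elim: h => [|i h IH]; first by rewrite /= big_seq1 adjmx1 mul1mx mulmx1.
rewrite [LHS]/= meas_branch_unitary IH [chains _ _]/= big_allpairs_dep.
apply: eq_bigr => k _; rewrite mulmx_sumr mulmx_suml; apply: eq_bigr => c _.
by rewrite [amp (_ :: _) _ _]/= adjmxM !mulmxA.
Qed.

(** The effect pulled back through every query of a chain: the weight under the trivial device
    without its factors [1/d]. *)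
Fixpoint total G rho (As : seq ('I_d -> 'M[C]_m)) : C :=
  if As is A :: As' then total (pull A G) rho As' else \tr (G *m rho).

Lemma trivial_povmE (i s t : 'I_d) : trivial_povm R i s t = (s == t)%:R / d%:R :> C.
Proof. by rewrite mxE; case: (s == t); rewrite ?mulr1n ?mulr0n ?mul0r ?mul1r. Qed.

(** A trivial query is [1/d] times the partial trace, and its slices are the terms of [pull]. *)
Lemma trace_branch_trivial p G h : \tr (G *m branch_rev p (@trivial_povm R d) h) =
  (d%:R ^- size h) * \sum_(c <- chains p h) total G (p_rho0 p) c.
Proof.
elim: h G => [|i h IH] G; first by rewrite /= big_seq1 expr0 invr1 mul1r.
rewrite [branch_rev _ _ _]/= [chains _ _]/= big_allpairs_dep /=.
set X := branch_rev _ _ h in IH *.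
have -> : meas_branch (trivial_povm R i) (apply_channel (p_E p (rev h)) X) =
    d%:R^-1 *: \sum_(k <- p_E p (rev h)) \sum_s kstep k s *m X *m adjmx (kstep k s).
  rewrite meas_branchE exchange_big scaler_sumr /apply_channel /=.
  under [RHS]eq_bigr do rewrite scaler_sumr.
  rewrite [RHS]exchange_big /=; apply: eq_bigr => s _.
  rewrite (bigD1 s) //= [X in _ + X]big1 ?addr0 => [|t ts]; last first.
    by rewrite trivial_povmE (negPf ts) mul0r scale0r.
  rewrite trivial_povmE eqxx mul1r -scaler_sumr mulmx_sumr mulmx_suml.
  by congr (_ *: _); apply: eq_bigr => k _; rewrite /kstep adjmxM !mulmxA.
rewrite -scalemxAr mxtraceZ exprS invfM -mulrA; congr (_ * _).
rewrite mulmx_sumr mxtrace_sum mulr_sumr; apply: eq_bigr => k _.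
rewrite -IH /pull mulmx_sumr mulmx_suml !mxtrace_sum; apply: eq_bigr => s _.
by rewrite !mulmxA mxtrace_mulC !mulmxA.
Qed.

Lemma trace_channel (K : seq 'M[C]_(d * m, m)) X : kraus_channel K ->
  \tr (apply_channel K X) = \tr X.
Proof.
move=> hK; rewrite -[in RHS](mul1mx X) -hK mulmx_suml !mxtrace_sum.
by apply: eq_bigr => k _; rewrite mxtrace_mulC mulmxA.
Qed.

Lemma trace_slices (X : 'M[C]_(d * m)) :
  \sum_s \tr (slice s *m X *m adjmx (slice s)) = \tr X.
Proof.
rewrite {2}/mxtrace (reindex _ (curry_mxvec_bij d m)) /=.
under eq_bigr => s _ do rewrite /mxtrace; rewrite pair_bigA /=.
by apply: eq_bigr => -[s a] _ /=; exact: slice_sandwich.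
Qed.

Lemma trace_meas_branch_complete M (X : 'M[C]_(d * m)) : \sum_i M i = 1%:M ->
  \sum_i \tr (meas_branch (M i) X) = \tr X.
Proof.
move=> hM; rewrite -mxtrace_sum -[RHS]trace_slices -mxtrace_sum; congr (\tr _).
under eq_bigr do rewrite meas_branchE.
rewrite exchange_big; apply: eq_bigr => s _; rewrite exchange_big /=.
under eq_bigr => t _ do rewrite -scaler_suml -summxE hM mxE.
rewrite (bigD1 s) //= eqxx scale1r big1 ?addr0 // => t ts.
by rewrite eq_sym (negPf ts) scale0r.
Qed.

(** The outcomes of the trivial device are uniform whatever the tester prepares, because channels
    and partial traces preserve the trace. *)
Lemma trace_branch_trivial_id p h : valid_protocol p ->
  \tr (branch_rev p (@trivial_povm R d) h) = d%:R ^- size h.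
Proof.
case=> -[_ tr1] hK _ _; elim: h => [|i h IH]; first by rewrite /= expr0 invr1.
rewrite /= exprS invfM -IH.
rewrite -(trace_channel (branch_rev p (@trivial_povm R d) h) (hK (rev h))).
set X := apply_channel _ _.
rewrite meas_branchE mxtrace_sum -(trace_slices X) mulr_sumr.
apply: eq_bigr => s _; rewrite (bigD1 s) //= big1 ?addr0 => [|t ts].
  by rewrite trivial_povmE eqxx mul1r mxtraceZ.
by rewrite trivial_povmE eq_sym (negPf ts) mul0r scale0r.
Qed.

End Protocol.

Lemma big_tuple_cons (V : nmodType) (T : finType) n (F : seq T -> V) :
  \sum_(h : n.+1.-tuple T) F h = \sum_(x : T) \sum_(h : n.-tuple T) F (x :: h).
Proof.
rewrite pair_bigA /=.
pose g (xh : T * n.-tuple T) : n.+1.-tuple T := [tuple of xh.1 :: xh.2].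
rewrite (reindex g) //=; exists (fun h => (thead h, [tuple of behead h])).
  by move=> [x h] _; rewrite /g theadE; congr pair; apply: val_inj.
by move=> h _; rewrite /g -tuple_eta.
Qed.

(** Reconciles the order in time used by [accept_prob] with the latest-first order of
    [branch_rev]. *)
Lemma big_tuple_rev (V : nmodType) (T : finType) n (F : seq T -> seq T -> V) :
  \sum_(h : n.-tuple T) F h (rev h) = \sum_(h : n.-tuple T) F (rev h) h.
Proof.
rewrite (reindex_inj (h := fun h : n.-tuple T => [tuple of rev h])).
  by apply: eq_bigr => h _; rewrite /= revK.
by move=> h1 h2 /(congr1 val) /= /(can_inj revK) /val_inj.
Qed.

(** * Conservation of probability and the rejection probability *)

Section Normalization.
Variables (R : realType) (d m : nat).
Local Notation C := R[i].
Implicit Types (U : 'M[C]_d) (p : protocol R d m) (M : 'I_d -> 'M[C]_d).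

Lemma sum_trace_branch p M n : valid_protocol p -> \sum_i M i = 1%:M ->
  \sum_(h : n.-tuple 'I_d) \tr (branch_rev p M h) = 1.
Proof.
case=> -[_ tr1] hK _ _ hM; elim: n => [|n IH].
  rewrite (big_pred1 [tuple]) /= ?tr1 // => h.
  by apply/esym/eqP; rewrite /= [h]tuple0.
rewrite (big_tuple_cons n (fun h => \tr (branch_rev p M h))) exchange_big /= -[RHS]IH; apply: eq_bigr => h _.
by rewrite trace_meas_branch_complete // trace_channel.
Qed.

Lemma unitary_povm_complete U : unitary_mx U -> \sum_i unitary_povm U i = 1%:M.
Proof.
move=> UU; rewrite -UU; apply/matrixP => s t; rewrite summxE mxE.
by apply: eq_bigr => i _; rewrite unitary_povmE !mxE.
Qed.

Lemma trivial_povm_complete : (0 < d)%N -> \sum_i @trivial_povm R d i = 1%:M.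
Proof.
move=> d0; apply/matrixP => s t; rewrite summxE.
under eq_bigr do rewrite trivial_povmE.
by rewrite sumr_const card_ord -[LHS]mulr_natr divfK ?mxE // pnatr_eq0 -lt0n.
Qed.

(** Rejection also has a positive effect, so lower bounds on branch weights apply to it; a lower
    bound under the Haar device limits the acceptance there. *)
Definition reject_prob n p M : R := \sum_(h : n.-tuple 'I_d)
  complex.Re (\tr ((1%:M - p_F p (rev h)) *m branch_rev p M h)).

Lemma accept_probE p M n : valid_protocol p -> \sum_i M i = 1%:M ->
  accept_prob n p M = 1 - reject_prob n p M.
Proof.
move=> vp hM; have := congr1 (@complex.Re R) (sum_trace_branch n vp hM).
rewrite Re_sum /= => <-; rewrite /reject_prob -sumrB /accept_prob.
rewrite (big_tuple_rev n (fun h hr => complex.Re (\tr (p_F p h *m branch_rev p M hr)))).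
apply: eq_bigr => h _; rewrite -ReB -raddfB /=; congr (complex.Re (\tr _)).
by rewrite mulmxBl mul1mx opprB addrC subrK.
Qed.

End Normalization.

(** * Polynomial functions of a matrix *)

Section PolynomialFunctions.
Variables (R : realType) (d : nat).
Local Notation C := R[i].
Implicit Types (g : 'M[C]_d -> C) (U : 'M[C]_d).

(** Polynomials in the entries and their conjugates: a class containing all weights, on which
    continuity, boundedness on unitaries and measurability follow by induction. *)
Inductive cpoly : ('M[C]_d -> C) -> Prop :=
| cpoly_cst c : cpoly (fun=> c)
| cpoly_entry i j : cpoly (fun U => U i j)
| cpoly_conj g : cpoly g -> cpoly (fun U => (g U)^*)
| cpoly_add g h : cpoly g -> cpoly h -> cpoly (fun U => g U + h U)
| cpoly_mul g h : cpoly g -> cpoly h -> cpoly (fun U => g U * h U).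

Lemma cpoly_sum (I : Type) (r : seq I) (P : pred I) (F : I -> 'M[C]_d -> C) :
  (forall i, cpoly (F i)) -> cpoly (fun U => \sum_(i <- r | P i) F i U).
Proof.
move=> hF; elim: r => [|i r IH].
  by under eq_fun do rewrite big_nil; exact: cpoly_cst.
by under eq_fun do rewrite big_cons; case: (P i) => //; exact: cpoly_add.
Qed.

Lemma cpoly_comp g (Phi : 'M[C]_d -> 'M[C]_d) : cpoly g ->
  (forall i j, cpoly (fun U => Phi U i j)) -> cpoly (fun U => g (Phi U)).
Proof.
move=> cg hPhi; elim: cg => [c|i j|? _ IH|? ? _ IH1 _ IH2|? ? _ IH1 _ IH2].
- exact: cpoly_cst.
- exact: hPhi.
- exact: cpoly_conj.
- exact: cpoly_add.
- exact: cpoly_mul.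
Qed.

Definition mxpoly_fun m n (F : 'M[C]_d -> 'M[C]_(m, n)) :=
  forall i j, cpoly (fun U => F U i j).

Lemma mxpoly_fun_cst m n (A : 'M[C]_(m, n)) : mxpoly_fun (fun=> A).
Proof. by move=> i j; exact: cpoly_cst. Qed.

Lemma mxpoly_fun_id : mxpoly_fun id.
Proof. by move=> i j; exact: cpoly_entry. Qed.

Lemma mxpoly_fun_mul m n q (F : 'M[C]_d -> 'M[C]_(m, n)) (H : 'M[C]_d -> 'M[C]_(n, q)) :
  mxpoly_fun F -> mxpoly_fun H -> mxpoly_fun (fun U => F U *m H U).
Proof.
move=> hF hH i j; under eq_fun do rewrite mxE.
by apply: cpoly_sum => k; exact: cpoly_mul.
Qed.

Lemma mxpoly_fun_adj m n (F : 'M[C]_d -> 'M[C]_(m, n)) :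
  mxpoly_fun F -> mxpoly_fun (fun U => adjmx (F U)).
Proof.
by move=> hF i j; under eq_fun do rewrite adjmxE; exact: cpoly_conj.
Qed.

Lemma cpoly_trace n (F : 'M[C]_d -> 'M[C]_n) :
  mxpoly_fun F -> cpoly (fun U => \tr (F U)).
Proof. by move=> hF; apply: cpoly_sum. Qed.

Lemma mxpoly_fun_amp m (As : seq ('I_d -> 'M[C]_m)) js : mxpoly_fun (amp As js).
Proof.
elim: As js => [|A As IH] [|j js]; try exact: mxpoly_fun_cst.
apply: mxpoly_fun_mul => // a b; under eq_fun do rewrite summxE.
apply: cpoly_sum => s; under eq_fun do rewrite !mxE.
by apply: cpoly_mul; [apply: cpoly_conj; exact: cpoly_entry|exact: cpoly_cst].
Qed.

Lemma unitary_mxV U : unitary_mx U -> unitary_mx (adjmx U).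
Proof. by rewrite /unitary_mx adjmxK; exact: mulmx1C. Qed.

Lemma unitary_mxM U V : unitary_mx U -> unitary_mx V -> unitary_mx (U *m V).
Proof.
move=> uU uV; rewrite /unitary_mx adjmxM mulmxA -(mulmxA U) uV mulmx1; exact: uU.
Qed.

Lemma unitary_entry_le1 U i j : unitary_mx U ->
  `|complex.Re (U i j)| <= 1 /\ `|complex.Im (U i j)| <= 1.
Proof.
move=> /matrixP/(_ i i)/(congr1 (@complex.Re R)); rewrite !mxE Re_sum eqxx /=.
have ReMJ (z : C) : complex.Re (z * z^*) = complex.Re z ^+ 2 + complex.Im z ^+ 2.
  by case: z => x y /=; ring.
under eq_bigr => k _ do rewrite adjmxE ReMJ.
rewrite (bigD1 j) //= => h.
have : complex.Re (U i j) ^+ 2 + complex.Im (U i j) ^+ 2 <= 1.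
  by rewrite -[leRHS]h lerDl sumr_ge0 // => k _; rewrite addr_ge0 ?sqr_ge0.
have := sqr_ge0 (complex.Re (U i j)); have := sqr_ge0 (complex.Im (U i j)).
move=> a b c; rewrite -!sqrtr_sqr -sqrtr1 !ler_sqrt //.
by split; lra.
Qed.

Definition clip (x : R) : R := Num.max (-1) (Num.min 1 x).

Lemma clip_id x : `|x| <= 1 -> clip x = x.
Proof. by rewrite ler_norml => /andP[? ?]; rewrite /clip min_r // max_r. Qed.

Lemma clip_le1 x : `|clip x| <= 1.
Proof.
rewrite /clip ler_norml le_max lexx /= ge_max ge_min lexx /= andbT; lra.
Qed.

Lemma clip_continuous (T : topologicalType) (f : T -> R) :
  continuous f -> continuous (fun x => clip (f x)).
Proof.
move=> cf x.
apply: (@continuous_max R T (fun=> -1) ((fun=> 1) \min f)); first exact: cvg_cst.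
by apply: (@continuous_min R T (fun=> 1) f); [exact: cvg_cst|exact: cf].
Qed.

Definition bcont (f : 'M[R]_(d, d + d) -> R) :=
  continuous f /\ exists B : R, forall x, `|f x| <= B.

Lemma bcont_cst c : bcont (fun=> c).
Proof. by split; [exact: (@cst_continuous _ _ c)|exists `|c|]. Qed.

Lemma bcontD f h : bcont f -> bcont h -> bcont (fun x => f x + h x).
Proof.
move=> [cf [B hB]] [ch [B' hB']]; split.
  by move=> x; exact: (cvgD (cf x) (ch x)).
by exists (B + B') => x; rewrite (le_trans (ler_normD _ _)) // lerD.
Qed.

Lemma bcontM f h : bcont f -> bcont h -> bcont (fun x => f x * h x).
Proof.
move=> [cf [B hB]] [ch [B' hB']]; split.
  by move=> x; exact: (cvgM (cf x) (ch x)).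
by exists (B * B') => x; rewrite normrM ler_pM.
Qed.

Lemma bcontN f : bcont f -> bcont (fun x => - f x).
Proof.
move=> [cf [B hB]]; split; first by move=> x; exact: (cvgN (cf x)).
by exists B => x; rewrite normrN.
Qed.

(* The invariance of the Haar law is only given for bounded test functions;
   clipping the entries to [-1, 1] makes a polynomial bounded without changing
   it on unitary matrices. *)
Lemma cpoly_bcont g : cpoly g -> exists fr fi, [/\ bcont fr, bcont fi &
  forall U, unitary_mx U ->
    complex.Re (g U) = fr (reim U) /\ complex.Im (g U) = fi (reim U)].
Proof.
elim=> [c|i j|{}g _ [fr [fi [cr ci E]]]|{}g h _ [fr [fi [cr ci E]]] _ [fr' [fi' [cr' ci' E']]]
  |{}g h _ [fr [fi [cr ci E]]] _ [fr' [fi' [cr' ci' E']]]].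
- exists (fun=> complex.Re c), (fun=> complex.Im c).
  by split=> //; exact: bcont_cst.
- exists (fun x => clip (x i (lshift d j))), (fun x => clip (x i (rshift d j))).
  split=> [||U uU].
  + split; last by exists 1 => x; exact: clip_le1.
    exact/clip_continuous/coord_continuous.
  + split; last by exists 1 => x; exact: clip_le1.
    exact/clip_continuous/coord_continuous.
  have [hr hi] := unitary_entry_le1 i j uU.
  by rewrite /reim row_mxEl row_mxEr !mxE !clip_id.
- exists fr, (fun x => - fi x); split=> //; first exact: bcontN.
  by move=> U /E[<- <-]; rewrite Re_conj Im_conj.
- exists (fun x => fr x + fr' x), (fun x => fi x + fi' x).
  split; [exact: bcontD|exact: bcontD|move=> U uU].
  by have [<- <-] := E U uU; have [<- <-] := E' U uU; rewrite ReD ImD.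
- exists (fun x => fr x * fr' x + - (fi x * fi' x)),
    (fun x => fr x * fi' x + fi x * fr' x).
  split; [apply: bcontD; [exact: bcontM|exact/bcontN/bcontM]|
          apply: bcontD; exact: bcontM|move=> U uU].
  by have [<- <-] := E U uU; have [<- <-] := E' U uU; rewrite ReM ImM.
Qed.

Definition cmeas (dT : measure_display) (T : measurableType dT) (f : T -> C) :=
  measurable_fun setT (fun x => complex.Re (f x)) /\
  measurable_fun setT (fun x => complex.Im (f x)).

Lemma cmeasD (dT : measure_display) (T : measurableType dT) (f h : T -> C) :
  cmeas f -> cmeas h -> cmeas (fun x => f x + h x).
Proof.
move=> [fr fi] [hr hi]; split.
  by under eq_fun do rewrite ReD; exact: measurable_funD.
by under eq_fun do rewrite ImD; exact: measurable_funD.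
Qed.

Lemma cmeasM (dT : measure_display) (T : measurableType dT) (f h : T -> C) :
  cmeas f -> cmeas h -> cmeas (fun x => f x * h x).
Proof.
move=> [fr fi] [hr hi]; split.
  by under eq_fun do rewrite ReM; apply: measurable_funB; exact: measurable_funM.
by under eq_fun do rewrite ImM; apply: measurable_funD; exact: measurable_funM.
Qed.

Lemma cmeas_conj (dT : measure_display) (T : measurableType dT) (f : T -> C) :
  cmeas f -> cmeas (fun x => (f x)^*).
Proof.
move=> [fr fi]; split; first by under eq_fun do rewrite Re_conj.
by under eq_fun do rewrite Im_conj; exact: measurableT_comp.
Qed.

Lemma cmeas_sum (dT : measure_display) (T : measurableType dT) (I : Type)
    (r : seq I) (F : I -> T -> C) :
  (forall i, cmeas (F i)) -> cmeas (fun x => \sum_(i <- r) F i x).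
Proof.
move=> hF; elim: r => [|i r IH].
  by under eq_fun do rewrite big_nil; split; exact: measurable_cst.
by under eq_fun do rewrite big_cons; exact: cmeasD.
Qed.

(** Reduces measurability to the entries; this serves the integrand in two variables of [haar_adj],
    a matrix built from two independent copies of [U]. *)
Lemma cpoly_cmeas (dT : measure_display) (T : measurableType dT) g
    (X : T -> 'M[C]_d) : cpoly g ->
  (forall i j, cmeas (fun x => X x i j)) -> cmeas (fun x => g (X x)).
Proof.
move=> cg hX; elim: cg => [c|i j|? _ IH|? ? _ IH1 _ IH2|? ? _ IH1 _ IH2].
- by split; exact: measurable_cst.
- exact: hX.
- exact: cmeas_conj.
- exact: cmeasD.
- exact: cmeasM.
Qed.

End PolynomialFunctions.

(** * Expectations under the Haar law *)

Section RealPolynomialFunctions.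
Variables (R : realType) (d : nat).
Local Notation C := R[i].
Implicit Types (f : 'M[C]_d -> R).

Definition rpoly f := exists2 g, cpoly g & forall X, f X = complex.Re (g X).

Lemma rpoly_cst c : rpoly (fun=> c).
Proof. by exists (fun=> c%:C%C); [exact: cpoly_cst|]. Qed.

Lemma rpolyD f1 f2 : rpoly f1 -> rpoly f2 -> rpoly (fun X => f1 X + f2 X).
Proof.
move=> [g1 c1 e1] [g2 c2 e2]; exists (fun X => g1 X + g2 X); first exact: cpoly_add.
by move=> X; rewrite ReD e1 e2.
Qed.

Lemma rpolyZ c f : rpoly f -> rpoly (fun X => c * f X).
Proof.
move=> [g cg e]; exists (fun X => c%:C%C * g X).
  by apply: cpoly_mul => //; exact: cpoly_cst.
by move=> X; rewrite ReMl e.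
Qed.

Lemma rpoly_sum (I : Type) (r : seq I) (P : pred I) (F : I -> 'M[C]_d -> R) :
  (forall i, rpoly (F i)) -> rpoly (fun X => \sum_(i <- r | P i) F i X).
Proof.
move=> hF; elim: r => [|i r IH].
  by under eq_fun do rewrite big_nil; exact: rpoly_cst.
by under eq_fun do rewrite big_cons; case: (P i) => //; exact: rpolyD.
Qed.

Lemma rpoly_comp f (Phi : 'M[C]_d -> 'M[C]_d) : rpoly f ->
  mxpoly_fun Phi -> rpoly (fun X => f (Phi X)).
Proof.
move=> [g cg e] hPhi; exists (fun X => g (Phi X)); first exact: cpoly_comp.
by move=> X; rewrite e.
Qed.

Lemma rpoly_weight m (G rho : 'M[C]_m) As js : rpoly (weight G rho As js).
Proof.
exists (fun X => sform G rho (amp As js X) (amp As js X)) => //.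
apply: cpoly_trace; apply: mxpoly_fun_mul; last first.
  exact/mxpoly_fun_adj/mxpoly_fun_amp.
apply: mxpoly_fun_mul; last exact: mxpoly_fun_cst.
by apply: mxpoly_fun_mul; [exact: mxpoly_fun_cst|exact: mxpoly_fun_amp].
Qed.

End RealPolynomialFunctions.

Section HaarExpectation.
Variables (R : realType) (d : nat) (d0 : measure_display).
Variables (Omega : measurableType d0) (P : probability Omega R).
Variable U : Omega -> 'M[R[i]]_d.
Hypothesis haarU : haar_distributed P U.
Local Notation C := R[i].
Implicit Types (f : 'M[C]_d -> R) (V W : 'M[C]_d).

Let uU w : unitary_mx (U w).
Proof. by case: haarU. Qed.

Lemma rpoly_bcont f : rpoly f ->
  exists2 h, bcont h & forall X, unitary_mx X -> f X = h (reim X).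
Proof.
move=> [g cg e]; have [fr [fi [cr _ E]]] := cpoly_bcont cg.
by exists fr => // X /E[<- _]; rewrite e.
Qed.

Lemma integrable_haar f : rpoly f -> P.-integrable setT (EFin \o (fun w => f (U w))).
Proof.
move=> /rpoly_bcont[h [ch [B hB]] E]; have [_ mU _] := haarU.
have -> : (fun w => f (U w)) = (fun w => h (reim (U w))).
  by apply/funext => w; rewrite E.
apply: measurable_bounded_integrable => //.
- exact: (le_lt_trans (probability_le1 P measurableT) (ltry _)).
- exact: mU.
exists B; split; first exact: num_real.
by move=> x Bx w _; rewrite /= (le_trans (hB _)) // ltW.
Qed.

Lemma haar_left f V : rpoly f -> unitary_mx V ->
  (\int[P]_w (f (V *m U w))%:E = \int[P]_w (f (U w))%:E)%E.
Proof.
move=> /rpoly_bcont[h [ch bh] E] uV; have [_ _ inv] := haarU.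
transitivity (\int[P]_w (h (reim (V *m U w)))%:E)%E.
  by apply: eq_integral => w _; rewrite (E _ (unitary_mxM uV (uU w))).
rewrite (inv V uV h ch bh).
by apply: eq_integral => w _; rewrite (E _ (uU w)).
Qed.

Lemma haar_entry_cmeas i j : cmeas (fun w => U w i j).
Proof.
have [fr [fi [[cr _] [ci _] E]]] := cpoly_bcont (@cpoly_entry R d i j).
have [_ mU _] := haarU; split.
  by under eq_fun => w do rewrite (E _ (uU w)).1; exact: mU.
by under eq_fun => w do rewrite (E _ (uU w)).2; exact: mU.
Qed.

(* Fubini for [f (U(w')^* U(w))]: integrating first in [w] or first in [w'], left
   invariance removes the other variable. *)
Lemma haar_adj f : rpoly f ->
  (\int[P]_w (f (U w))%:E = \int[P]_w (f (adjmx (U w)))%:E)%E.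
Proof.
move=> rf.
have rfa : rpoly (fun X => f (adjmx X)).
  exact/(rpoly_comp rf)/mxpoly_fun_adj/mxpoly_fun_id.
pose F (z : Omega * Omega) := (f (adjmx (U z.1) *m U z.2))%:E.
have intF : (P \x P)%E.-integrable setT F.
  have [h [ch [B hB]] E] := rpoly_bcont rf.
  have -> : F = EFin \o (fun z => f (adjmx (U z.1) *m U z.2)) by [].
  apply: measurable_bounded_integrable => //.
  - rewrite -setXTT [ltLHS]product_measure1E //.
    apply: (@le_lt_trans _ _ (1 * 1)%E); last by rewrite mule1 ltry.
    by rewrite lee_pmul // probability_le1.
  - have [g cg e] := rf; under eq_fun do rewrite e.
    suff : cmeas (fun z : Omega * Omega => g (adjmx (U z.1) *m U z.2)) by case.
    apply: cpoly_cmeas => // i j; under eq_fun do rewrite mxE.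
    apply: cmeas_sum => k; under eq_fun do rewrite adjmxE.
    apply: cmeasM.
      apply: cmeas_conj; have [mr mi] := haar_entry_cmeas k i.
      by split; [exact: (measurableT_comp mr measurable_fst)|
        exact: (measurableT_comp mi measurable_fst)].
    have [mr mi] := haar_entry_cmeas k j.
    by split; [exact: (measurableT_comp mr measurable_snd)|
        exact: (measurableT_comp mi measurable_snd)].
  exists B; split; first exact: num_real.
  move=> x Bx z _ /=; rewrite E; last exact/unitary_mxM/uU/unitary_mxV/uU.
  by rewrite (le_trans (hB _)) // ltW.
have cstint (k : \bar R) : (\int[P]_w k = k)%E.
  by rewrite integral_cst // [X in (_ * X)%E](probability_setT P) mule1.
have := Fubini intF; rewrite /F /=.
under eq_integral => w _ do rewrite (haar_left rf (unitary_mxV (uU w))).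
rewrite cstint => ->.
transitivity (\int[P]_y (\int[P]_w (f (adjmx (U w)))%:E))%E; last by rewrite cstint.
apply: eq_integral => y _.
rewrite -(haar_left rfa (unitary_mxV (uU y))).
by apply: eq_integral => w _; rewrite adjmxM adjmxK.
Qed.

(** Taking adjoints, which preserves the law by [haar_adj], turns right multiplication into left
    multiplication by [adjmx W]. *)
Lemma haar_right f W : rpoly f -> unitary_mx W ->
  (\int[P]_w (f (U w *m W))%:E = \int[P]_w (f (U w))%:E)%E.
Proof.
move=> rf uW.
have rW : rpoly (fun X => f (X *m W)).
  by apply/(rpoly_comp rf)/mxpoly_fun_mul; [exact: mxpoly_fun_id|exact: mxpoly_fun_cst].
have rfa : rpoly (fun X => f (adjmx X)).
  exact/(rpoly_comp rf)/mxpoly_fun_adj/mxpoly_fun_id.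
rewrite (haar_adj rW) (haar_adj rf) -(haar_left rfa (unitary_mxV uW)).
by apply: eq_integral => w _; rewrite adjmxM adjmxK.
Qed.

Definition expect f : R := fine (\int[P]_w (f (U w))%:E)%E.

Lemma expectK f : rpoly f -> (\int[P]_w (f (U w))%:E = (expect f)%:E)%E.
Proof.
by move=> /integrable_haar rf; rewrite fineK //; exact: (integrable_fin_num _ rf).
Qed.

Lemma expectD f1 f2 : rpoly f1 -> rpoly f2 ->
  expect (fun X => f1 X + f2 X) = expect f1 + expect f2.
Proof. by move=> /integrable_haar i1 /integrable_haar i2; exact: RintegralD. Qed.

Lemma expectZ c f : rpoly f -> expect (fun X => c * f X) = c * expect f.
Proof. by move=> /integrable_haar i1; exact: RintegralZl. Qed.

Lemma expect_cst c : expect (fun=> c) = c.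
Proof. by rewrite /expect integral_cst // [X in (_ * X)%E](probability_setT P) mule1. Qed.

Lemma expect_sum (I : Type) (r : seq I) (Q : pred I) (F : I -> 'M[C]_d -> R) :
  (forall i, rpoly (F i)) ->
  expect (fun X => \sum_(i <- r | Q i) F i X) = \sum_(i <- r | Q i) expect (F i).
Proof.
move=> hF; elim: r => [|i r IH].
  under [X in expect X]eq_fun do rewrite big_nil; by rewrite big_nil expect_cst.
rewrite big_cons -IH; under [X in expect X]eq_fun do rewrite big_cons.
by case: (Q i) => //; rewrite expectD //; exact: rpoly_sum.
Qed.

Lemma expect_le f1 f2 : rpoly f1 -> rpoly f2 ->
  (forall X, unitary_mx X -> f1 X <= f2 X) -> expect f1 <= expect f2.
Proof.
move=> /integrable_haar i1 /integrable_haar i2 h; apply: le_Rintegral => // w _.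
exact: h.
Qed.

Lemma eq_expect f1 f2 : (forall X, unitary_mx X -> f1 X = f2 X) ->
  expect f1 = expect f2.
Proof. by move=> h; rewrite /expect; under eq_integral do rewrite h //. Qed.

Lemma expect_right f W : rpoly f -> unitary_mx W ->
  expect (fun X => f (X *m W)) = expect f.
Proof. by move=> rf uW; rewrite /expect haar_right. Qed.

End HaarExpectation.

(** * The lower bound on distinct outcomes *)

Lemma ler_sum_all (R : realType) (T : Type) (s : seq T) (Q : pred T) (F H : T -> R) :
  all Q s -> (forall x, Q x -> F x <= H x) -> \sum_(x <- s) F x <= \sum_(x <- s) H x.
Proof.
move=> + FH; elim: s => [|x s IH] /=; first by rewrite !big_nil.
by move=> /andP[Qx Qs]; rewrite !big_cons lerD ?FH ?IH.
Qed.

Section LowerBound.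
Variables (R : realType) (d m : nat) (d0 : measure_display).
Variables (Omega : measurableType d0) (P : probability Omega R).
Variable U : Omega -> 'M[R[i]]_d.
Hypothesis haarU : haar_distributed P U.
Local Notation C := R[i].
Local Notation E := (expect P U).
Implicit Types (A : 'I_d -> 'M[C]_m) (G rho : 'M[C]_m).
Implicit Types (As : seq ('I_d -> 'M[C]_m)) (js : seq 'I_d).

(** In the expectation of [weight_mix], right invariance erases every rotation. With [x] for outcome
    [a] and [y] for [b] this reads [x <= 337/625 * x + 576/625 * y], that is [x <= 2 * y]. *)
Lemma expect_weight_repeat G rho A As js a b : psd G -> psd rho ->
  uniq js -> size As = size js -> a \in js -> b \notin js ->
  E (weight G rho (A :: As) (a :: js)) <= 2 * E (weight G rho (A :: As) (b :: js)).
Proof.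
move=> pG prho ujs sAs ajs bjs.
have ab : a != b by apply: contraNneq bjs => <-.
have mix X := weight_mix A X pG prho ujs sAs ajs bjs.
set wa := weight G rho (A :: As) (a :: js) in mix *.
set wb := weight G rho (A :: As) (b :: js) in mix *.
have ra : rpoly wa by exact: rpoly_weight.
have rb : rpoly wb by exact: rpoly_weight.
clearbody wa wb.
have rR f W : rpoly f -> rpoly (fun X : 'M[C]_d => f (X *m W)).
  move=> rf; apply: (rpoly_comp rf); apply: mxpoly_fun_mul.
    exact: mxpoly_fun_id.
  exact: mxpoly_fun_cst.
have uH z : unitary_mx (mixmx a b z : 'M[C]_d) by exact: mixmx_unitary.
move: mix.
move: (mixmx a b (2 * 1)) (uH (2 * 1)) (mixmx a b (2 * 'i%C)) (uH (2 * 'i%C)).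
move: (mixmx a b (2 * -1)) (uH (2 * -1)) (mixmx a b (2 * - 'i%C)) (uH (2 * - 'i%C)).
move: (swapmx R a b) (swapmx_unitary R ab) => S uS H3 u3 H4 u4 H1 u1 H2 u2 mix.
have rl := rpolyD (rpolyD (rpolyD (rR _ H1 ra) (rR _ H2 ra)) (rR _ H3 ra)) (rR _ H4 ra).
have rr3 := rpolyZ (144 / 625) (rpolyD (rpolyZ 2 rb) (rpolyZ 2 (rR _ S rb))).
have rr2 := rpolyD (rpolyZ (81 / 625) ra) (rpolyZ (256 / 625) (rR _ S ra)).
have := expect_le haarU rl (rpolyZ 4 (rpolyD rr2 rr3)) (fun X _ => mix X).
rewrite !(expectD haarU, expectZ haarU, expect_right haarU) //;
  do ?[exact: rR | apply: rpolyZ | apply: rpolyD] => //.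
by move: (E wa) (E wb) => x y; lra.
Qed.

(** Summing over the latest outcome, each of the [d] values counts once and each of the [size js]
    repeated ones at most once more. *)
Lemma expect_weight_step G rho A As i js : psd G -> psd rho ->
  uniq (i :: js) -> size As = size js ->
  E (weight (pull A G) rho As js) <=
  (d + size js)%:R * E (weight G rho (A :: As) (i :: js)).
Proof.
move=> pG prho /= /andP[ijs ujs] sAs.
have rw j : rpoly (weight G rho (A :: As) (j :: js)) by exact: rpoly_weight.
rewrite -(@eq_expect _ _ _ _ P U haarU _ _ (fun X uX => sum_weight G rho A As js uX)).
rewrite (expect_sum haarU) //.
set f := E (weight G rho (A :: As) (i :: js)).
apply: (@le_trans _ _ (\sum_(j < d) (1 + (j \in js)%:R) * f)).
  apply: ler_sum => j _; have [jjs|jjs] := boolP (j \in js).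
    by rewrite -[1 + _]/(2 : R); exact: expect_weight_repeat.
  (* Two new outcomes have the same expectation, by swapping their columns. *)
  rewrite mulr0n addr0 mul1r /f; have [->//|ij] := eqVneq i j.
  rewrite -(expect_right haarU (rw i) (swapmx_unitary R ij)).
  by under [X in _ <= E X]eq_fun do rewrite (weight_swap _ _ _ _ _ ijs jjs ij).
rewrite -mulr_suml big_split /= sumr_const card_ord natrD -natr_sum.
rewrite (_ : (\sum_(j < d) (j \in js) = size js)%N) //.
rewrite -(card_uniqP ujs) -sum1_card [RHS]big_mkcond /=.
by apply: eq_bigr => j _; case: (j \in js).
Qed.

(** Induction from the latest query: the hypothesis is applied to the pulled-back effect, and
    [expect_weight_step] restores the query at the cost of one more factor. *)
Lemma expect_weight_total G rho As js : psd G -> psd rho ->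
  uniq js -> size As = size js ->
  complex.Re (total G rho As) <=
  (\prod_(k < size js) (d + k)%:R) * E (weight G rho As js).
Proof.
move=> + prho; elim: js As G => [|i js IH] [|A As] G pG //.
  move=> _ _; rewrite big_ord0 mul1r /=.
  rewrite (@eq_expect _ _ _ _ P U haarU _ (fun=> complex.Re (\tr (G *m rho)))) ?expect_cst //.
  by move=> X _; rewrite /weight /qform /sform /= adjmx1 !mulmx1.
move=> uijs [sAs]; have /= /andP[_ ujs] := uijs.
apply: (le_trans (IH As (pull A G) (pull_psd A pG) ujs sAs)).
rewrite big_ord_recr /= -mulrA ler_wpM2l ?prodr_ge0 //.
exact: expect_weight_step.
Qed.

Lemma total_ge0 G rho As : psd G -> psd rho -> 0 <= complex.Re (total G rho As).
Proof.
move=> + prho; elim: As G => [|A As IH] G pG /=; last exact/IH/pull_psd.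
by have := qform_ge0 1%:M pG prho; rewrite /qform /sform adjmx1 !mulmx1.
Qed.

Lemma trace_branch_unitary (p : protocol R d m) G h X :
  complex.Re (\tr (G *m branch_rev p (unitary_povm X) h)) =
  \sum_(c <- chains p h) weight G (p_rho0 p) c h X.
Proof.
rewrite branch_unitary mulmx_sumr mxtrace_sum Re_sum; apply: eq_bigr => c _.
by rewrite /weight /qform /sform !mulmxA.
Qed.

Lemma rpoly_trace_branch (p : protocol R d m) G h :
  rpoly (fun X => complex.Re (\tr (G *m branch_rev p (unitary_povm X) h))).
Proof.
under eq_fun do rewrite trace_branch_unitary.
by apply: rpoly_sum => c; exact: rpoly_weight.
Qed.

Lemma Re_trace_branch_trivial (p : protocol R d m) G h :
  complex.Re (\tr (G *m branch_rev p (@trivial_povm R d) h)) =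
  d%:R ^- size h * \sum_(c <- chains p h) complex.Re (total G (p_rho0 p) c).
Proof.
rewrite trace_branch_trivial -Re_sum -ReMl; congr (complex.Re (_ * _)).
by rewrite fmorphV rmorphXn rmorph_nat.
Qed.

Definition ratio n : R := d%:R ^+ n / \prod_(k < n) (d + k)%:R.

(** Compare chain by chain with [expect_weight_total]; the numerator of [ratio] cancels the factors
    [1/d] of the trivial device. *)
Lemma expect_branch_ge (p : protocol R d m) G h : (0 < d)%N ->
  valid_protocol p -> psd G -> uniq h ->
  ratio (size h) * complex.Re (\tr (G *m branch_rev p (@trivial_povm R d) h)) <=
  E (fun X => complex.Re (\tr (G *m branch_rev p (unitary_povm X) h))).
Proof.
move=> d_gt0 [[prho _] _ _ _] pG uh.
under [X in _ <= E X]eq_fun do rewrite trace_branch_unitary.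
rewrite (expect_sum haarU); last by move=> c; exact: rpoly_weight.
have prod_gt0 : 0 < \prod_(k < size h) (d + k)%:R :> R.
  by apply: prodr_gt0 => k _; rewrite ltr0n addn_gt0 d_gt0.
rewrite Re_trace_branch_trivial /ratio mulrACA divff ?mul1r; last first.
  by rewrite expf_neq0 // pnatr_eq0 -lt0n.
rewrite mulrC ler_pdivrMr // mulr_suml.
apply: (ler_sum_all (size_chains p h)) => c /eqP sc.
by rewrite mulrC; exact: expect_weight_total.
Qed.

Lemma expect_branch_ge0 (p : protocol R d m) G h : valid_protocol p -> psd G ->
  0 <= E (fun X => complex.Re (\tr (G *m branch_rev p (unitary_povm X) h))).
Proof.
move=> [[prho _] _ _ _] pG; rewrite -(@expect_cst _ _ _ _ P U 0).
apply: (expect_le haarU); [exact: rpoly_cst|exact: rpoly_trace_branch|].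
move=> X _; rewrite trace_branch_unitary sumr_ge0 // => c _.
exact: weight_ge0.
Qed.

End LowerBound.

(** * Repetitions and the conclusion *)

Section Counting.
Variables (R : realType) (d : nat).
Hypothesis d_gt0 : (0 < d)%N.

Let dR_gt0 : 0 < d%:R :> R.
Proof. by rewrite ltr0n. Qed.

(** The induction step shared by the next two bounds: as [x <= 1], the factor [q] costs at most
    [n/d], and [n^2 + n <= (n+1)^2]. *)
Lemma mul_lower_bound n (x q : R) : 0 <= x <= 1 -> 0 <= q <= 1 ->
  1 - n%:R ^+ 2 / d%:R <= x -> 1 - n%:R / d%:R <= q ->
  0 <= x * q <= 1 /\ 1 - n.+1%:R ^+ 2 / d%:R <= x * q.
Proof.
move=> /andP[x0 x1] /andP[q0 q1] hx hq.
split; first by rewrite mulr_ge0 //= mulr_ile1.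
have nd : 0 <= n%:R / d%:R :> R by rewrite divr_ge0.
have : x - n%:R / d%:R <= x * q.
  apply: le_trans (ler_wpM2l x0 hq); rewrite mulrBr mulr1 lerD2l lerN2.
  by rewrite ler_piMl.
have : n.+1%:R ^+ 2 / d%:R = n%:R ^+ 2 / d%:R + n%:R / d%:R + (n%:R + 1) / d%:R :> R.
  by rewrite -natr1; ring.
have : 0 <= (n%:R + 1) / d%:R :> R by rewrite divr_ge0 // addr_ge0.
by lra.
Qed.

Lemma ratio_bounds n :
  0 <= ratio R d n <= 1 /\ 1 - n%:R ^+ 2 / d%:R <= ratio R d n.
Proof.
elim: n => [|n [r01 IH]].
  by rewrite /ratio big_ord0 expr0 divr1 ler01 lexx expr0n /= mul0r subr0.
have dn : 0 < (d + n)%:R :> R by rewrite ltr0n addn_gt0 d_gt0.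
have -> : ratio R d n.+1 = ratio R d n * (d%:R / (d + n)%:R).
  by rewrite /ratio big_ord_recr /= exprSr invfM mulrACA.
apply: mul_lower_bound => //.
  by rewrite divr_ge0 //= ler_pdivrMr // mul1r ler_nat leq_addr.
rewrite ler_pdivlMr // natrD mulrBl mul1r mulrDr divfK ?gt_eqF //.
have : 0 <= n%:R / d%:R * n%:R :> R by rewrite mulr_ge0 // divr_ge0.
by lra.
Qed.

(** The birthday bound: the quotient is the probability that [n] uniform outcomes are distinct. *)
Lemma falling_bounds n : 0 <= ((d ^_ n)%:R / d%:R ^+ n : R) <= 1 /\
  1 - n%:R ^+ 2 / d%:R <= ((d ^_ n)%:R / d%:R ^+ n : R).
Proof.
elim: n => [|n [r01 IH]].
  by rewrite ffactn0 expr0 divr1 ler01 lexx expr0n /= mul0r subr0.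
have -> : (d ^_ n.+1)%:R / d%:R ^+ n.+1 =
    (d ^_ n)%:R / d%:R ^+ n * ((d - n)%:R / d%:R) :> R.
  by rewrite ffactnSr natrM exprSr invfM mulrACA.
apply: mul_lower_bound => //.
  by rewrite divr_ge0 //= ler_pdivrMr // mul1r ler_nat leq_subr.
(* The subtraction [d - n] is truncated, but truncation only enlarges it, so [n > d] is covered. *)
rewrite ler_pdivlMr // mulrBl mul1r divfK ?gt_eqF //.
by rewrite lerBlDr -natrD ler_nat addnC -maxnE leq_maxr.
Qed.

Lemma sum_uniq_tuples n :
  \sum_(h : n.-tuple 'I_d | uniq h) d%:R ^- n = (d ^_ n)%:R / d%:R ^+ n :> R.
Proof.
rewrite sumr_const -[LHS]mulr_natl; congr (_%:R * _).
rewrite -[in RHS](card_ord d) -(card_uniq_tuples n (@predT 'I_d)).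
by apply: eq_card => h; rewrite !inE all_predT.
Qed.

End Counting.

(** * Rejection probabilities of the two devices compared *)

Section Distinguishing.
Variables (R : realType) (d : nat) (d0 : measure_display).
Variables (Omega : measurableType d0) (P : probability Omega R).
Variable U : Omega -> 'M[R[i]]_d.
Hypothesis haarU : haar_distributed P U.
Local Notation E := (expect P U).

(** One loss of [n^2/d] comes from the factor [ratio] on distinct histories, the other from giving
    up the histories with a repetition. *)
Lemma expect_reject_ge n m (p : protocol R d m) : (0 < d)%N -> valid_protocol p ->
  reject_prob n p (@trivial_povm R d) - 2 * (n%:R ^+ 2 / d%:R) <=
  E (fun X => reject_prob n p (unitary_povm X)).
Proof.
move=> d_gt0 vp; have [[prho _] _ pF pG] := vp.
pose r (h : n.-tuple 'I_d) : R :=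
  complex.Re (\tr ((1%:M - p_F p (rev h)) *m branch_rev p (@trivial_povm R d) h)).
(* Positivity of [p_F] bounds rejection on [h] by the probability of [h] itself. *)
have r_le h : r h <= d%:R ^- n.
  have := Re_trace_branch_trivial p (p_F p (rev h)) h.
  have := congr1 (@complex.Re R) (trace_branch_trivial_id h vp).
  rewrite size_tuple -(rmorph_nat (real_complex R)) -rmorphXn -fmorphV /= => e1 e2.
  rewrite /r mulmxBl mul1mx raddfB /= ReB e1 e2 gerBl mulr_ge0 ?invr_ge0 ?exprn_ge0 //.
  by apply: sumr_ge0 => c _; exact: total_ge0.
have split_r : reject_prob n p (@trivial_povm R d) =
    \sum_(h : n.-tuple 'I_d | uniq h) r h + \sum_(h : n.-tuple 'I_d | ~~ uniq h) r h.
  by rewrite /reject_prob (bigID (fun h : n.-tuple 'I_d => uniq h)).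
have tot1 : \sum_(h : n.-tuple 'I_d) d%:R ^- n = 1 :> R.
  rewrite sumr_const card_tuple card_ord -[LHS]mulr_natl natrX divff //.
  by rewrite expf_neq0 // pnatr_eq0 -lt0n.
have nonuniq : \sum_(h : n.-tuple 'I_d | ~~ uniq h) r h <=
    1 - (d ^_ n)%:R / d%:R ^+ n.
  rewrite -sum_uniq_tuples -[X in X - _]tot1.
  rewrite [X in _ <= X - _](bigID (fun h : n.-tuple 'I_d => uniq h)) /=.
  rewrite addrAC subrr add0r.
  by apply: ler_sum => h _.
have r_sum_le : \sum_(h : n.-tuple 'I_d | uniq h) r h <= 1.
  have := falling_bounds R d_gt0 n; rewrite -sum_uniq_tuples => -[/andP[_ h1] _].
  by apply: le_trans h1; apply: ler_sum => h _.
have [/andP[a0 a1] ha] := ratio_bounds R d_gt0 n.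
have [/andP[b0 b1] hb] := falling_bounds R d_gt0 n.
have lower : ratio R d n * (\sum_(h : n.-tuple 'I_d | uniq h) r h) <=
    E (fun X => reject_prob n p (unitary_povm X)).
  rewrite (expect_sum haarU); last by move=> h; exact: rpoly_trace_branch.
  rewrite [leRHS](bigID (fun h : n.-tuple 'I_d => uniq h)) /= mulr_sumr.
  rewrite -[leLHS]addr0 lerD //.
    apply: ler_sum => h uh.
    by rewrite -[X in ratio R d X](size_tuple h); exact: expect_branch_ge.
  by apply: sumr_ge0 => h _; exact: expect_branch_ge0.
move: split_r nonuniq r_sum_le lower => ->.
move: (\sum_(h | uniq _) r h) (\sum_(h | ~~ uniq _) r h) => x y hy hx hl.
(* This product linearises the goal: it gives [x - ratio * x <= 1 - ratio]. *)
have : 0 <= (1 - ratio R d n) * (1 - x) by rewrite mulr_ge0 // subr_ge0.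
move: (E _) (ratio R d n) (_ / d%:R ^+ n) (_ / d%:R) a1 ha b1 hb hy hl.
by move=> e a b q; lra.
Qed.

End Distinguishing.

Theorem theorem1 (R : realType) (delta : R) :
  0 < delta ->
  exists c : R, 0 < c /\
    forall (d : nat) (d0 : measure_display) (Omega : measurableType d0)
           (P : probability Omega R) (U : Omega -> 'M[R[i]]_d),
      haar_distributed P U ->
      forall (n m : nat) (p : protocol R d m),
        valid_protocol p ->
        ((1 / 2 + delta)%:E <= success_prob P U n p)%E ->
        c * Num.sqrt (d%:R) <= n%:R.
Proof.
(* The bound [delta <= n^2/d] will be turned into the claim by taking square roots. *)
move=> delta_gt0; exists (Num.sqrt delta); split; first by rewrite sqrtr_gt0.
move=> d d0 Omega P U haarU n m p vp.
have [d_0|d_gt0] := posnP d; first by move=> _; rewrite d_0 sqrtr0 mulr0.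
have [uU _ _] := haarU.
have := expect_reject_ge haarU n d_gt0 vp.
have rrej : rpoly (fun X => reject_prob n p (unitary_povm X)).
  by apply: rpoly_sum => h; exact: rpoly_trace_branch.
set rU := expect _ _ _; set rT := reject_prob n p _ => rUT.
have accU : (\int[P]_w (accept_prob n p (unitary_povm (U w)))%:E = (1 - rU)%:E)%E.
  transitivity (\int[P]_w (1 + -1 * reject_prob n p (unitary_povm (U w)))%:E)%E.
    apply: eq_integral => w _.
    by rewrite accept_probE ?mulN1r //; exact/unitary_povm_complete/uU.
  have rr := rpolyD (rpoly_cst d 1) (rpolyZ (-1) rrej).
  rewrite (expectK haarU rr) (expectD haarU (rpoly_cst d 1) (rpolyZ (-1) rrej)).
  by rewrite (expectZ haarU _ rrej) expect_cst mulN1r.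
rewrite /success_prob accU accept_probE //; last exact: trivial_povm_complete.
rewrite -EFinM -EFinD lee_fin -/rT => succ.
have dR : 0 < d%:R :> R by rewrite ltr0n.
(* The success probability is [1/2 + (rT - rU)/2], and [rT - rU] is at most [2 * n^2/d]. *)
have key : delta * d%:R <= n%:R ^+ 2.
  rewrite -ler_pdivlMr //.
  by move: succ rUT; move: (_ / d%:R) => q; lra.
rewrite -(sqrtrM _ (ltW delta_gt0)) -[n%:R]ger0_norm // -sqrtr_sqr.
exact: ler_wsqrtr.
Qed.
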